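(* Let $b,\rho\ge 0$ and $\mu_{\min}\ge 0$ satisfy $2\rho b\le \mu_{\min}$, let $F$ be a $(b,\rho)$-robust summation, and let $\mathcal G\in\Gamma_{\mu_{\min},b}$. Let $0<\eta\le \mu_{\max}(\mathcal G_{\mathcal H})^{-1}$. Then for all honest parameters $(x_i)_{i\in\mathcal H}\in(\mathbb R^d)^{\mathcal H}$ and all (arbitrary) messages sent by the Byzantine nodes, the output $(x_i^+)_{i\in\mathcal H}$ of one step of $F$-RG satisfies $$\frac1{|\mathcal H|}\sum_{i\in\mathcal H}\|x_i^+-\overline x_{\mathcal H}\|^2\le \bigl(1-\eta(\mu_{\min}-2\rho b)\bigr)\,\mathrm{Var}_{\mathcal H}(x),$$ $$\|\overline x_{\mathcal H}^{+}-\overline x_{\mathcal H}\|^2\le 2\rho b\,\eta\,\mathrm{Var}_{\mathcal H}(x).$$ Consequently, if $2\rho b<\mu_{\min}$, $F$-RG is $r$-robust on every such $\mathcal G\in\Gamma_{\mu_{\min},b}$ with $r=1-\eta(\mu_{\min}-2\rho b)$.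
   Context: Graph setting: $\mathcal G$ is a finite undirected graph with symmetric nonnegative edge weights $w_{ij}=w_{ji}$, whose node set is partitioned into honest nodes $\mathcal H$ ($|\mathcal H|\ge 2$) and Byzantine nodes $\mathcal B$. $n(i)$ is the set of neighbors of $i$, $n_{\mathcal H}(i)=n(i)\cap\mathcal H$, $n_{\mathcal B}(i)=n(i)\cap\mathcal B$, and $b(i)=\sum_{j\in n_{\mathcal B}(i)}w_{ij}$. $\mathcal G_{\mathcal H}$ is the subgraph induced on $\mathcal H$, and $W_{\mathcal H}$ is its weighted Laplacian ($(W_{\mathcal H})_{ij}=-w_{ij}$ for $i\ne j$, $(W_{\mathcal H})_{ii}=\sum_{j\in n_{\mathcal H}(i)}w_{ij}$). $\mu_2(\mathcal G_{\mathcal H})$ and $\mu_{\max}(\mathcal G_{\mathcal H})$ are the second smallest (counted with multiplicity) and the largest eigenvalue of $W_{\mathcal H}$. For $\mu_{\min},b\ge0$, $\Gamma_{\mu_{\min},b}$ is the class of such graphs with $\mu_2(\mathcal G_{\mathcal H})\ge\mu_{\min}$ and $\max_{i\in\mathcal H}b(i)\le b$. Robust summation: an aggregation rule $F$ (defined for every number $n$ of inputs) maps $(\omega_i,z_i)_{i\in[n]}\in(\mathbb R_+\times\mathbb R^d)^n$ to $\mathbb R^d$. It is a $(b,\rho)$-robust summation if for all vectors $z_i\in\mathbb R^d$, all weights $\omega_i\ge0$ and all $S\subset[n]$ with $\sum_{i\in[n]\setminus S}\omega_i\le b$, $$\Bigl\|F\bigl((\omega_i,z_i)_{i\in[n]}\bigr)-\sum_{i\in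 S}\omega_iz_i\Bigr\|^2\le\rho b\sum_{i\in S}\omega_i\|z_i\|^2.$$ $F$-RG with step-size $\eta>0$: each honest node $i$ computes $x_i^+=x_i-\eta F\bigl((w_{ij},x_i-x_j)_{j\in n(i)}\bigr)$, where for $j\in n_{\mathcal B}(i)$ the vector $x_j$ received by $i$ is arbitrary and may differ from one receiver $i$ to another. Notation: $\overline x_{\mathcal H}=|\mathcal H|^{-1}\sum_{i\in\mathcal H}x_i$, $\overline x_{\mathcal H}^{+}=|\mathcal H|^{-1}\sum_{i\in\mathcal H}x_i^+$, $\mathrm{Var}_{\mathcal H}(x)=|\mathcal H|^{-1}\sum_{i\in\mathcal H}\|x_i-\overline x_{\mathcal H}\|^2$. For $r<1$, an algorithm is $r$-robust on $\mathcal G$ if for any initial honest parameters $(x_i)_{i\in\mathcal H}$ (and any Byzantine behavior) the honest outputs satisfy $\frac1{|\mathcal H|}\sum_{i\in\mathcal H}\|x_i^+-\overline x_{\mathcal H}\|^2\le r\,\frac1{|\mathcal H|}\sum_{i\in\mathcal H}\|x_i-\overline x_{\mathcal H}\|^2$. *)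

(* Defs.v *)
From mathcomp Require Import all_boot all_order all_algebra.
From mathcomp Require Import reals.
From mathcomp Require Import polyrcf.

Set Implicit Arguments.
Unset Strict Implicit.
Unset Printing Implicit Defensive.

Import Order.TTheory GRing.Theory Num.Theory.
Local Open Scope ring_scope.

Definition enorm (R : realType) (d : nat) (v : 'rV[R]_d) : R :=
  Num.sqrt (\sum_(k < d) v 0 k ^+ 2).

(* Nondecreasing list of the real eigenvalues of [A], each repeated according
   to its algebraic multiplicity (it has length [n] when [A] is symmetric). *)
Definition spectrum (R : realType) (n : nat) (A : 'M[R]_n) : seq R :=
  flatten [seq nseq (mup a (char_poly A)) a | a <- rootsR (char_poly A)].

(* [edge] and [weight] are separate data since weight-0 edges are allowed: they
   are still inputs of the aggregation rule. Byzantine nodes are [~: honest]. *)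
Record network (R : realType) (V : finType) := Network {
  edge : rel V;
  weight : V -> V -> R;
  honest : {set V};
  edge_sym : symmetric edge;
  edge_irrefl : irreflexive edge;
  weight_sym : forall i j, weight i j = weight j i;
  weight_ge0 : forall i j, 0 <= weight i j;
  weight_nonedge : forall i j, ~~ edge i j -> weight i j = 0;
  honest_ge2 : (2 <= #|honest|)%N
}.

Section Network.
Variables (R : realType) (V : finType) (G : network R V).

Definition nbr (i : V) : {set V} := [set j | edge G i j].
Definition nbrH (i : V) : {set V} := nbr i :&: honest G.
Definition nbrB (i : V) : {set V} := nbr i :&: ~: honest G.

Definition byz_weight (i : V) : R := \sum_(j in nbrB i) weight G i j.

Definition laplacianH : 'M[R]_#|honest G| :=
  \matrix_(p, q)
    if p == q then \sum_(k in nbrH (enum_val p)) weight G (enum_val p) k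
    else - weight G (enum_val p) (enum_val q).

Definition mu2 : R := nth 0 (spectrum laplacianH) 1.
Definition mu_max : R := last 0 (spectrum laplacianH).

Definition in_Gamma (mu_min b : R) : Prop :=
  mu_min <= mu2 /\ forall i, i \in honest G -> byz_weight i <= b.

End Network.

Definition aggregation_rule (R : realType) (d : nat) :=
  forall n : nat, {ffun 'I_n -> R * 'rV[R]_d} -> 'rV[R]_d.

(* [F] is total on real weights; only nonnegative ones are ever constrained. *)
Definition robust_summation (R : realType) (d : nat) (b rho : R)
    (F : aggregation_rule R d) : Prop :=
  forall (n : nat) (omega : 'I_n -> R) (z : 'I_n -> 'rV[R]_d) (S : {set 'I_n}),
    (forall k, 0 <= omega k) ->
    \sum_(k in ~: S) omega k <= b ->
    enorm (F n [ffun k => (omega k, z k)] - \sum_(k in S) omega k *: z k) ^+ 2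
      <= rho * b * \sum_(k in S) omega k * enorm (z k) ^+ 2.

Section Algorithms.
Variables (R : realType) (d : nat) (V : finType) (G : network R V).

(* Parameters are indexed by all of [V]; only those of honest nodes are
   meaningful. *)
Definition meanH (x : V -> 'rV[R]_d) : 'rV[R]_d :=
  (#|honest G|%:R)^-1 *: \sum_(i in honest G) x i.

Definition msdH (y : V -> 'rV[R]_d) (c : 'rV[R]_d) : R :=
  (#|honest G|%:R)^-1 * \sum_(i in honest G) enorm (y i - c) ^+ 2.

Definition VarH (x : V -> 'rV[R]_d) : R := msdH x (meanH x).

(* Maps the initial parameters [x] and the Byzantine messages [m] to the
   outputs; [m i j] is the vector that Byzantine node [j] sends to [i]. *)
Definition algorithm :=
  (V -> 'rV[R]_d) -> (V -> V -> 'rV[R]_d) -> V -> 'rV[R]_d.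

Definition received (x : V -> 'rV[R]_d) (m : V -> V -> 'rV[R]_d) (i j : V) :
    'rV[R]_d :=
  if j \in honest G then x j else m i j.

(* The neighbours of [i] are numbered by [enum_val : 'I_#|nbr G i| -> V]; [F]
   is not assumed to be permutation invariant. *)
Definition RG (F : aggregation_rule R d) (eta : R) : algorithm :=
  fun x m i =>
    x i - eta *: F #|nbr G i|
      [ffun k => (weight G i (enum_val k), x i - received x m i (enum_val k))].

Definition r_robust (A : algorithm) (r : R) : Prop :=
  r < 1 /\ forall x m, msdH (A x m) (meanH x) <= r * msdH x (meanH x).

End Algorithms.

(* Main.v *)
(* With L the honest Laplacian and e_i the aggregation error at i, one step reads
   x^+ = (I - eta L) x - eta e, and robustness gives |e|^2 <= 2 rho b E with
   E = <x, L x> (coordinates are centered, so x is orthogonal to the constants).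
   On that subspace the spectrum of L lies in [mu_min, 1/eta], whence
   |(I - eta L) x|^2 <= (1 - eta mu_min) (|x|^2 - eta E).
   Applying |u - v|^2 <= |u|^2 / (1 - t) + |v|^2 / t with t = eta mu_min yields
   |x^+|^2 <= |x|^2 - eta (1 - 2 rho b / mu_min) E, and E >= mu_min |x|^2.
   The honest flows cancel in the mean, so the drift is eta times the mean of e,
   and eta E <= |x|^2 concludes. *)

Require Import Defs.
From mathcomp Require Import all_boot all_order all_algebra.
From mathcomp Require Import reals.
From mathcomp Require Import polyrcf complex.
From mathcomp Require Import ring lra.

Set Implicit Arguments.
Unset Strict Implicit.
Unset Printing Implicit Defensive.

Import Order.TTheory GRing.Theory Num.Theory.
Local Open Scope ring_scope.

(** * Diagonalization of real symmetric matrices *)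

Lemma char_poly_conj (F : fieldType) n (P D : 'M[F]_n) : P \in unitmx ->
  char_poly (invmx P *m D *m P) = char_poly D.
Proof.
move=> uP; pose Q := map_mx (@polyC F) P; pose Q' := map_mx (@polyC F) (invmx P).
have Q'Q : Q' *m Q = 1%:M by rewrite -map_mxM mulVmx // map_mx1.
rewrite /char_poly; have -> : char_poly_mx (invmx P *m D *m P) =
    Q' *m char_poly_mx D *m Q.
  rewrite /char_poly_mx mulmxBr mulmxBl !map_mxM; congr (_ - _).
  by rewrite -[in RHS]scalemx1 -scalemxAr mulmx1 -scalemxAl Q'Q scalemx1.
by rewrite !det_mulmx mulrAC -det_mulmx Q'Q det1 mul1r.
Qed.

Section Spectral.
Local Open Scope sesquilinear_scope.
Local Open Scope complex_scope.

(** Over [R[i]] the matrix becomes Hermitian, hence normal, so it is unitarily diagonalizable;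
    Hermitian symmetry makes the eigenvalues real, which allows [d] to be a real vector. *)
Lemma symmetric_spectral (R : rcfType) n (A : 'M[R]_n) : A^T = A ->
  exists (P : 'M[R[i]]_n) (d : 'rV[R]_n), P \is unitarymx /\
    map_mx (real_complex R) A =
      P^t* *m diag_mx (map_mx (real_complex R) d) *m P.
Proof.
move=> symA; pose B := map_mx (real_complex R) A.
have Bherm : B \is hermsymmx.
  apply: realsym_hermsym.
    by apply/is_hermitianmxP; rewrite expr0 scale1r map_mx_id // map_trmx symA.
  by apply/mxOverP => i j; rewrite mxE complex_real.
have uP := spectral_unitarymx B.
exists (spectralmx B), (map_mx (@complex.Re R) (spectral_diag B)); split=> //.
rewrite -invmx_unitary //.
have -> : map_mx (real_complex R) (map_mx (@complex.Re R) (spectral_diag B)) =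
    spectral_diag B.
  apply/matrixP=> i j; rewrite !mxE RRe_real //.
  exact/mxOverP/hermitian_spectral_diag_real.
exact/orthomx_spectralP/hermitian_normalmx.
Qed.

(* [c v i] is the squared modulus of the [i]-th coordinate of [v] in a
   complex orthonormal eigenbasis; no real eigenbasis is needed. *)
Lemma symmetric_fourier (R : rcfType) n (A : 'M[R]_n) : A^T = A ->
  exists (d : 'I_n -> R) (c : 'rV[R]_n -> 'I_n -> R),
  [/\ char_poly A = \prod_i ('X - (d i)%:P),
      forall (v : 'rV[R]_n) i, 0 <= c v i,
      forall v : 'rV[R]_n, \sum_i v 0 i ^+ 2 = \sum_i c v i,
      forall v : 'rV[R]_n, \sum_i (v *m A) 0 i * v 0 i = \sum_i d i * c v i
    & (forall (v : 'rV[R]_n) i, c (v *m A) i = d i ^+ 2 * c v i) /\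
      (forall (u v : 'rV[R]_n) i0, u != 0 -> \sum_i u 0 i * v 0 i = 0 ->
        (forall i, i != i0 -> c u i = 0) -> c v i0 = 0)].
Proof.
move=> /symmetric_spectral[P [d [uP AE]]].
pose w (v : 'rV[R]_n) := map_mx (real_complex R) v *m P^t*.
have PP : P^t* *m P = 1%:M.
  by rewrite -(invmx_unitary uP) mulVmx // unitarymx_unit.
have conjR (r : R) : Num.conj (r%:C : R[i]) = r%:C := conjc_real r.
have wA (v : 'rV[R]_n) i : w (v *m A) 0 i = w v 0 i * (d 0 i)%:C.
  have -> : w (v *m A) = w v *m diag_mx (map_mx (real_complex R) d).
    by rewrite /w map_mxM AE !mulmxA -[LHS]mulmxA (unitarymxP uP) mulmx1.
  by rewrite mul_mx_diag mxE [X in _ * X]mxE.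
(* Parseval: unitary coordinates preserve the inner product, and real vectors are their own
   conjugates. *)
have dotw (u v : 'rV[R]_n) : (\sum_i u 0 i * v 0 i)%:C =
    \sum_i w u 0 i * Num.conj (w v 0 i).
  transitivity ((w u *m (w v)^t*) 0 0).
    rewrite /w trmx_mul map_mxM map_trmx trmxK -map_mx_comp.
    rewrite (map_mx_id (@conjCK _)) mulmxA -[_ *m _ *m P]mulmxA PP mulmx1.
    rewrite rmorph_sum mxE; apply: eq_bigr => i _; rewrite !mxE rmorphM /=.
    by rewrite conjR.
  by rewrite mxE; apply: eq_bigr => i _; rewrite !mxE.
pose c (v : 'rV[R]_n) i := complex.Re (w v 0 i * Num.conj (w v 0 i)).
have cE v i : (c v i)%:C = w v 0 i * Num.conj (w v 0 i).
  by rewrite /c RRe_real // ger0_real // mul_conjC_ge0.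
exists (fun i => d 0 i), c; split.
- apply: (map_inj_poly (@complexI R)); first by rewrite rmorph0.
  rewrite map_char_poly AE -(invmx_unitary uP).
  have -> : char_poly (invmx P *m diag_mx (map_mx (real_complex R) d) *m P) =
     char_poly (diag_mx (map_mx (real_complex R) d)).
    exact/char_poly_conj/unitarymx_unit.
  rewrite char_poly_trig ?diag_mx_is_trig // rmorph_prod.
  by apply: eq_bigr => i _; rewrite !mxE eqxx mulr1n /= map_polyXsubC.
- by move=> v i; rewrite -ler0c cE mul_conjC_ge0.
- move=> v; apply: (@complexI R).
  rewrite (eq_bigr (fun i => v 0 i * v 0 i)) // dotw rmorph_sum.
  by apply: eq_bigr => i _; rewrite -cE.
- move=> v; apply: (@complexI R); rewrite dotw rmorph_sum.
  by apply: eq_bigr => i _; rewrite rmorphM /= cE wA; ring.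
split=> [v i|u v i0 u0 uv cu].
  apply: (@complexI R); rewrite [RHS]rmorphM /= !cE wA rmorphXn /=.
  by rewrite rmorphM /= conjR; ring.
(* A nonzero [u] carried by the single coordinate [i0] reduces Parseval to one product, so
   orthogonality to [u] forces [w v 0 i0 = 0]. *)
have wu i : i != i0 -> w u 0 i = 0.
  move=> /cu cu0; have := cE u i; rewrite cu0 => /esym/eqP.
  by rewrite mulf_eq0 conjC_eq0 orbb => /eqP.
have wu0 : w u 0 i0 != 0.
  apply: contraNneq u0 => wui0.
  have : w u = 0.
    by apply/rowP=> i; rewrite [RHS]mxE; have [->|/wu] := eqVneq i i0.
  move/(congr1 (mulmx^~ P)); rewrite /w -mulmxA PP mulmx1 mul0mx.
  by move/eqP; rewrite map_mx_eq0.
have := dotw u v; rewrite uv (bigD1 i0) //= big1 ?addr0 => [|i /wu ->]; last first.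
  by rewrite mul0r.
move/esym/eqP; rewrite mulf_eq0 (negPf wu0) conjC_eq0 /= => /eqP wv0.
by apply: (@complexI R); rewrite cE wv0 mul0r.
Qed.
End Spectral.

(** * The sorted list of eigenvalues *)

Section Spectrum.
Variables (R : realType) (n : nat) (A : 'M[R]_n).

Lemma spectrum_sorted : sorted <=%R (spectrum A).
Proof.
rewrite /spectrum; have := sorted_roots (- cauchy_bound (char_poly A))
  (cauchy_bound (char_poly A)) (char_poly A).
rewrite -/(rootsR _) lt_sorted_pairwise le_sorted_pairwise.
elim: (rootsR _) => //= a s IH /andP[/allP a_lt s_lt].
rewrite pairwise_cat IH // andbT; apply/andP; split.
  apply/allrelP => x y /nseqP[-> _] /flattenP[_ /mapP[z zs ->] /nseqP[-> _]].
  exact/ltW/a_lt.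
by elim: (mup _ _) => //= k ->; rewrite andbT all_nseq lexx orbT.
Qed.

Lemma count_spectrum a :
  count_mem a (spectrum A) = mup a (char_poly A).
Proof.
have pN0 : char_poly A != 0 by apply/monic_neq0/char_poly_monic.
have [ra|Nra] := boolP (root (char_poly A) a); last first.
  rewrite mupNroot //; apply/count_memPn/flattenP => -[_ /mapP[z zs ->]].
  move=> /nseqP[az]; rewrite az in Nra *; rewrite -XsubC_dvd // dvdp_XsubCl.
  by apply/negP.
have aR : a \in rootsR (char_poly A).
  by rewrite -(roots_on_rootsR pN0) inE.
have uR : uniq (rootsR (char_poly A)) by exact/lt_sorted_uniq/sorted_roots.
rewrite /spectrum count_flatten -map_comp sumnE big_map (bigD1_seq a) //=.
rewrite count_nseq /= eqxx mul1n big1 ?addn0 // => b.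
by rewrite count_nseq /= => /negPf ->.
Qed.

(** Each value occurs in both lists as often as its multiplicity as a root. This links the entries
    of [spectrum] defining [mu2] and [mu_max] to the diagonal [d]. *)
Lemma perm_spectrum (d : 'I_n -> R) :
  char_poly A = \prod_i ('X - (d i)%:P) ->
  perm_eq (spectrum A) [seq d i | i <- enum 'I_n].
Proof.
move=> pE; apply/allP => a _ /=; apply/eqP; rewrite count_spectrum.
by rewrite pE -mu_prod_XsubC big_map big_enum.
Qed.

End Spectrum.

Lemma char_poly_root_ge0 (R : realType) n (A : 'M[R]_n) a :
  (forall v : 'rV_n, 0 <= \sum_i (v *m A) 0 i * v 0 i) ->
  root (char_poly A) a -> 0 <= a.
Proof.
move=> psdA; rewrite -eigenvalue_root_char => /eigenvalueP[v vA v0].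
have := psdA v; rewrite vA.
rewrite (eq_bigr (fun i => a * v 0 i ^+ 2)) => [|i _]; last by rewrite mxE; ring.
rewrite -mulr_sumr pmulr_lge0 // lt_neqAle sumr_ge0 ?andbT => [|i _]; last first.
  exact: sqr_ge0.
apply: contraNneq v0 => /esym /psumr_eq0P v0; apply/eqP/rowP => i.
by rewrite mxE; apply/eqP; rewrite -sqrf_eq0 v0 // => j _; exact: sqr_ge0.
Qed.

(** The minimum [a] must be the head of [s], so [t] is a permutation of the tail, whose head is
    entry 1. Only one copy of [a] is removed, so repeated minima are allowed. *)
Lemma sorted_le_nth1 (R : realType) (a : R) (s t : seq R) :
  sorted <=%R s -> perm_eq s (a :: t) -> (forall x, x \in t -> a <= x) ->
  forall x, x \in t -> nth 0 s 1 <= x.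
Proof.
case: s => [|y s] //= s_sorted st a_min x xt.
  by have := perm_size st.
have ya : y = a.
  have := mem_head a t; rewrite -(perm_mem st) inE => /predU1P[-> //|a_s].
  apply/le_anti/andP; split.
    by move/allP: (order_path_min le_trans s_sorted); apply.
  have := mem_head y s; rewrite (perm_mem st) inE => /predU1P[-> //|]; exact: a_min.
rewrite ya perm_cons in st s_sorted.
have xs : x \in s by rewrite (perm_mem st).
case: s s_sorted xs {st} => //= z s /andP[_ zs]; rewrite inE => /predU1P[-> //|].
by move/allP: (order_path_min le_trans zs); apply.
Qed.

Lemma sorted_le_last (R : realType) (s : seq R) x :
  sorted <=%R s -> x \in s -> x <= last 0 s.
Proof.
elim/last_ind: s => // s y _; rewrite last_rcons mem_rcons inE.
rewrite -[rcons s y]revK rev_sorted rev_rcons /= => /order_path_min ys.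
case/predU1P => [-> //|]; rewrite -mem_rev => xs.
by apply: (allP (ys _)) xs => a b c ba ac; exact: le_trans ac ba.
Qed.

(** * Contraction of a linear step orthogonally to a kernel vector *)

(** All quantities are diagonal in the eigenbasis, so each inequality is checked coordinate by
    coordinate from [eta * d i <= 1] and [0 <= c v i * (d i - mu)]. *)
Lemma psd_contraction (R : realType) n (A : 'M[R]_n) (u : 'rV[R]_n) (mu eta : R) :
  A^T = A -> (forall v : 'rV_n, 0 <= \sum_i (v *m A) 0 i * v 0 i) ->
  (1 < n)%N -> u != 0 -> u *m A = 0 ->
  0 <= mu -> mu <= nth 0 (spectrum A) 1 ->
  0 <= eta -> (last 0 (spectrum A) != 0 -> eta <= (last 0 (spectrum A))^-1) ->
  eta * mu <= 1 /\
  forall v : 'rV_n, \sum_i u 0 i * v 0 i = 0 ->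
    let N := \sum_i v 0 i ^+ 2 in
    let E := \sum_i (v *m A) 0 i * v 0 i in
    [/\ eta * E <= N, mu * N <= E &
      \sum_i (v 0 i - eta * (v *m A) 0 i) ^+ 2
        <= (1 - eta * mu) * (N - eta * E)].
Proof.
move=> symA psdA n_gt1 u0 uA mu0 mu_gap eta0 eta_max.
have [d [c [pE c0 cN cE [cA corth]]]] := symmetric_fourier symA.
have sorted_s := spectrum_sorted A.
have perm_s := perm_spectrum pE.
have dP i : root (char_poly A) (d i).
  by rewrite pE (bigD1 i) //= rootM root_XsubC eqxx.
have d0 i : 0 <= d i by exact: char_poly_root_ge0 (dP i).
have eta_d i : eta * d i <= 1.
  have d_last : d i <= last 0 (spectrum A).
    by apply: sorted_le_last => //; rewrite (perm_mem perm_s) map_f ?mem_enum.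
  (* If the largest eigenvalue is 0, all of them vanish and no bound on [eta] is needed. *)
  have [l0|lN0] := eqVneq (last 0 (spectrum A)) 0.
    have -> : d i = 0 by apply/le_anti; rewrite d0 -l0 d_last.
    by rewrite mulr0.
  have l_gt0 : 0 < last 0 (spectrum A).
    by rewrite lt_neqAle eq_sym lN0 (le_trans (d0 i)).
  rewrite (le_trans (ler_wpM2l eta0 d_last)) // -ler_pdivlMr // div1r.
  exact: eta_max.
have [i0 di0] : exists i0, d i0 = 0.
  have : root (char_poly A) 0.
    rewrite -eigenvalue_root_char; apply/eigenvalueP; exists u => //.
    by rewrite uA scale0r.
  rewrite pE rootE horner_prod => /prodf_eq0[i _].
  by rewrite hornerXsubC sub0r oppr_eq0 => /eqP di; exists i.
have gap i : i != i0 -> mu <= d i.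
  move=> ii0; apply: le_trans mu_gap _.
  apply: (sorted_le_nth1 (a := d i0) (t := [seq d j | j <- rem i0 (enum 'I_n)]));
    rewrite ?di0 // -?di0.
  - apply: perm_trans perm_s _; rewrite -map_cons; apply: perm_map.
    by rewrite perm_to_rem ?mem_enum.
  - by move=> _ /mapP[j _ ->]; rewrite di0.
  - by rewrite map_f // mem_rem_uniq ?enum_uniq // inE ii0 mem_enum.
(* Only [i0] can violate [mu <= d i]. If [mu = 0] it does not; otherwise the eigenvalue 0 is simple,
   [u] is carried by [i0], and orthogonality gives [c v i0 = 0]. *)
have weighted (v : 'rV[R]_n) i : \sum_j u 0 j * v 0 j = 0 -> 0 <= c v i * (d i - mu).
  move=> uv; have [->|ii0] := eqVneq i i0; last first.
    by rewrite mulr_ge0 // subr_ge0 gap.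
  have [->|muN0] := eqVneq mu 0; first by rewrite subr0 mulr_ge0.
  rewrite (corth u v i0) ?mul0r // => j /gap mu_d.
  have c00 : c 0 j = 0.
    apply: (psumr_eq0P (P := xpredT) (F := c 0)) => //.
    by rewrite -cN big1 // => k _; rewrite mxE expr0n.
  have := cA u j; rewrite uA c00 => /esym/eqP.
  rewrite mulf_eq0 expf_eq0 /= => /orP[/eqP dj|/eqP //].
  by case/negP: muN0; rewrite eq_le mu0 andbT -dj.
split.
  have [i ii0] : exists i : 'I_n, i != i0.
    apply/existsP; rewrite -negb_forall; apply/forallP => all_i0.
    move: n_gt1; rewrite -{1}(card_ord n) => /card_gt1P[i [j [_ _ /negP]]]; apply.
    by rewrite (eqP (all_i0 i)) (eqP (all_i0 j)).
  by apply: le_trans (eta_d i); rewrite ler_wpM2l // gap.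
move=> v uv N E; rewrite /N /E.
have -> : \sum_i (v 0 i - eta * (v *m A) 0 i) ^+ 2 =
    \sum_i (1 - eta * d i) ^+ 2 * c v i.
  transitivity (\sum_i v 0 i ^+ 2 - 2 * eta * (\sum_i (v *m A) 0 i * v 0 i)
      + eta ^+ 2 * (\sum_i (v *m A) 0 i ^+ 2)).
    rewrite !mulr_sumr -sumrB -big_split; apply: eq_bigr => i _ /=; ring.
  rewrite !cN cE !mulr_sumr -sumrB -big_split; apply: eq_bigr => i _ /=.
  by rewrite cA; ring.
rewrite cN cE; split.
- rewrite mulr_sumr; apply: ler_sum => i _; rewrite mulrA.
  by rewrite ler_piMl.
- rewrite mulr_sumr; apply: ler_sum => i _.
  by rewrite -subr_ge0 -mulrBl mulrC weighted.
- rewrite [eta * (\sum_i _)]mulr_sumr -sumrB mulr_sumr; apply: ler_sum => i _.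
  rewrite -subr_ge0; have -> : (1 - eta * mu) * (c v i - eta * (d i * c v i)) -
    (1 - eta * d i) ^+ 2 * c v i = (1 - eta * d i) * (eta * (c v i * (d i - mu))).
    ring.
  by rewrite mulr_ge0 ?subr_ge0 // mulr_ge0 // weighted.
Qed.

(** * Elementary inequalities for sums of squares *)

(* Convexity of the square: [(a - b)^2 <= a^2 / (1 - t) + b^2 / t]. *)
Lemma young_sum (R : realFieldType) (I : finType) (f g : I -> R) (t A B : R) :
  0 <= t <= 1 -> 0 <= A -> 0 <= B ->
  \sum_i f i ^+ 2 <= (1 - t) * A -> \sum_i g i ^+ 2 <= t * B ->
  \sum_i (f i - g i) ^+ 2 <= A + B.
Proof.
move=> /andP[t0 t1] A0 B0 fA gB.
have sq0 (F : I -> R) : \sum_i F i ^+ 2 <= 0 -> forall i, F i = 0.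
  move=> F0 i; apply/eqP; rewrite -sqrf_eq0; apply/eqP.
  have F2 j : 0 <= F j ^+ 2 by exact: sqr_ge0.
  have F20 : \sum_i F i ^+ 2 = 0 by apply/le_anti; rewrite F0 sumr_ge0.
  exact: (psumr_eq0P (fun j _ => F2 j) F20).
(* At the endpoints [t = 0] and [t = 1] one of the two families vanishes, which replaces the
   division. *)
have [t_0|tN0] := eqVneq t 0.
  move: fA gB; rewrite t_0 subr0 mul1r mul0r => fA /sq0 g0.
  under eq_bigr do rewrite g0 subr0.
  by rewrite (le_trans fA) // lerDl.
have [t_1|tN1] := eqVneq t 1.
  move: fA gB; rewrite t_1 subrr mul0r mul1r => /sq0 f0 gB.
  under eq_bigr do rewrite f0 sub0r sqrrN.
  by rewrite (le_trans gB) // lerDr.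
have t_gt0 : 0 < t by rewrite lt_neqAle eq_sym tN0.
have t_lt1 : 0 < 1 - t by rewrite subr_gt0 lt_neqAle tN1.
rewrite -(ler_pM2l (mulr_gt0 t_gt0 t_lt1)).
apply: (@le_trans _ _ (t * \sum_i f i ^+ 2 + (1 - t) * \sum_i g i ^+ 2)).
  rewrite !mulr_sumr -big_split; apply: ler_sum => i _ /=.
  (* This square equals [t f^2 + (1 - t) g^2 - t (1 - t) (f - g)^2]. *)
  by have := sqr_ge0 (t * f i + (1 - t) * g i); lra.
apply: (@le_trans _ _ (t * ((1 - t) * A) + (1 - t) * (t * B))); last by lra.
by apply: lerD; rewrite ler_pM2l.
Qed.

(** Cauchy-Schwarz against the all-ones vector, from Lagrange's identity for the sum of squared
    differences over all pairs. *)
Lemma sqr_sum_le (R : realDomainType) n (f : 'I_n -> R) :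
  (\sum_i f i) ^+ 2 <= n%:R * \sum_i f i ^+ 2.
Proof.
have : 0 <= \sum_i \sum_j (f i - f j) ^+ 2.
  by apply: sumr_ge0 => i _; apply: sumr_ge0 => j _; exact: sqr_ge0.
have -> : \sum_i \sum_j (f i - f j) ^+ 2 =
    2 * (n%:R * (\sum_i f i ^+ 2) - (\sum_i f i) ^+ 2).
  transitivity (\sum_i (n%:R * f i ^+ 2 - 2 * (f i * \sum_j f j)
      + \sum_j f j ^+ 2)).
    apply: eq_bigr => i _; rewrite (eq_bigr (fun j =>
      f i ^+ 2 - 2 * (f i * f j) + f j ^+ 2)) => [|j _]; last by ring.
    rewrite big_split sumrB /= sumr_const card_ord -!mulr_sumr.
    by rewrite -[f i ^+ 2 *+ n]mulr_natl.
  rewrite big_split sumrB /= sumr_const card_ord -!mulr_sumr -mulr_suml.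
  by rewrite -[_ *+ n]mulr_natl; ring.
by rewrite pmulr_rge0 // subr_ge0.
Qed.

Lemma enorm_sqr (R : realType) d (v : 'rV[R]_d) :
  enorm v ^+ 2 = \sum_k v 0 k ^+ 2.
Proof. by rewrite sqr_sqrtr // sumr_ge0 // => k _; exact: sqr_ge0. Qed.

(** * The honest Laplacian and its Dirichlet form *)

Section Laplacian.
Variables (R : realType) (V : finType) (G : network R V).
Local Notation h := #|honest G|.
Local Notation W p q := (weight G (@enum_val V (honest G) p) (enum_val q)).
Local Notation L := (laplacianH G).

Lemma weight_diag i : weight G i i = 0.
Proof. by apply: weight_nonedge; rewrite edge_irrefl. Qed.

Lemma sum_nbrH (U : zmodType) i (f : V -> U) :
  (forall j, ~~ edge G i j -> f j = 0) ->
  \sum_(j in nbrH G i) f j = \sum_(q < h) f (enum_val q).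
Proof.
move=> f0; rewrite -big_enum_val /= [RHS](bigID [pred j | edge G i j]) /=.
rewrite [X in _ + X]big1 ?addr0 => [|j /andP[_ /f0 //]].
by apply: eq_bigl => j; rewrite !inE andbC.
Qed.

Lemma laplacianH_sym : L^T = L.
Proof.
apply/matrixP => p q; rewrite !mxE eq_sym.
by have [->|_] := eqVneq q p; rewrite // weight_sym.
Qed.

Lemma mul_laplacianH (v : 'rV_h) q :
  (v *m L) 0 q = \sum_p W q p * (v 0 q - v 0 p).
Proof.
transitivity (\sum_p (v 0 q * W q p - v 0 p * W p q)); last first.
  by apply: eq_bigr => p _; rewrite (weight_sym _ (enum_val p)); ring.
rewrite sumrB -mulr_sumr mxE (bigD1 q) //=.
rewrite [in RHS](bigD1 q (F := fun p => v 0 p * W p q)) //=.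
rewrite weight_diag mulr0 add0r -sumrN mxE eqxx; congr (_ * _ + _).
  by apply: sum_nbrH => j /weight_nonedge.
by apply: eq_bigr => p /negPf pq; rewrite mxE pq mulrN.
Qed.

(** Swapping the two indices in one of two copies of the form symmetrizes it; each unordered pair is
    counted twice, whence the factor 2. *)
Lemma laplacianH_form (v : 'rV_h) :
  2 * \sum_q (v *m L) 0 q * v 0 q = \sum_q \sum_p W q p * (v 0 q - v 0 p) ^+ 2.
Proof.
under [in LHS]eq_bigr do rewrite mul_laplacianH mulr_suml.
rewrite mulr2n mulrDl mul1r {2}exchange_big -big_split; apply: eq_bigr => q _ /=.
rewrite -big_split; apply: eq_bigr => p _ /=.
by rewrite (weight_sym _ (enum_val p)); ring.
Qed.

Lemma laplacianH_psd (v : 'rV_h) : 0 <= \sum_q (v *m L) 0 q * v 0 q.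
Proof.
rewrite -(pmulr_rge0 _ (ltr0Sn R 1)) laplacianH_form.
apply: sumr_ge0 => q _; apply: sumr_ge0 => p _.
by rewrite mulr_ge0 ?weight_ge0 ?sqr_ge0.
Qed.

Lemma laplacianH_const : (const_mx 1 : 'rV_h) *m L = 0.
Proof.
apply/rowP => q; rewrite mul_laplacianH [RHS]mxE big1 // => p _.
by rewrite !mxE subrr mulr0.
Qed.

(** By symmetry, constants lie in both kernels of [L]: honest flows cancel in the mean. *)
Lemma sum_mul_laplacianH (v : 'rV_h) : \sum_q (v *m L) 0 q = 0.
Proof.
transitivity ((v *m L *m (const_mx 1)^T) 0 (0 : 'I_1)).
  rewrite [RHS]mxE; apply: eq_bigr => q _.
  by rewrite [X in _ * X]mxE [X in _ * X]mxE mulr1.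
by rewrite -mulmxA -{1}laplacianH_sym -trmx_mul laplacianH_const trmx0 mulmx0 mxE.
Qed.

End Laplacian.

(** * The aggregation error at one node *)

Section RobustGossip.
Variables (R : realType) (d : nat) (V : finType) (G : network R V).
Variables (b rho eta : R) (F : aggregation_rule R d).
Hypothesis robustF : robust_summation b rho F.

Definition agg x m i : 'rV[R]_d := F
  [ffun k => (weight G i (@enum_val V (nbr G i) k),
            x i - received G x m i (enum_val k))].

Definition honest_flow (x : V -> 'rV[R]_d) i :=
  \sum_(j in nbrH G i) weight G i j *: (x i - x j).

(** Robustness is applied with [S] the set of input positions held by honest neighbours; its
    complement has total weight [byz_weight G i]. *)
Lemma agg_error x m i : byz_weight G i <= b ->
  enorm (agg x m i - honest_flow x i) ^+ 2 <=
  rho * b * \sum_(j in nbrH G i) weight G i j * enorm (x i - x j) ^+ 2.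
Proof.
move=> byz_b; pose S := [set k | @enum_val V (nbr G i) k \in honest G].
have sumS (U : zmodType) (f g : V -> U) : (forall j, j \in honest G -> f j = g j) ->
    \sum_(k in S) f (enum_val k) = \sum_(j in nbrH G i) g j.
  move=> fg; transitivity (\sum_(j in nbr G i | j \in honest G) f j).
    by rewrite big_enum_val_cond; apply: eq_bigl => k; rewrite inE.
  by apply: eq_big => j; rewrite ?inE // => /andP[_ /fg].
have := @robustF #|nbr G i| (fun k => weight G i (enum_val k))
  (fun k => x i - received G x m i (enum_val k)) S.
rewrite (sumS _ (fun j => weight G i j *: (x i - received G x m i j))
  (fun j => weight G i j *: (x i - x j))); last first.
  by move=> j jH; rewrite /received jH.
rewrite (sumS _ (fun j => weight G i j * enorm (x i - received G x m i j) ^+ 2)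
  (fun j => weight G i j * enorm (x i - x j) ^+ 2)); last first.
  by move=> j jH; rewrite /received jH.
apply=> [k|]; first exact: weight_ge0.
apply: le_trans byz_b; rewrite le_eqVlt; apply/orP; left; apply/eqP.
transitivity (\sum_(j in nbr G i | j \notin honest G) weight G i j).
  by rewrite big_enum_val_cond; apply: eq_bigl => k; rewrite !inE.
by apply: eq_bigl => j; rewrite !inE.
Qed.
End RobustGossip.

(** * One step of the algorithm, coordinate by coordinate *)

Section OneStep.
Variables (R : realType) (d : nat) (V : finType) (G : network R V).
Variables (b rho mu eta : R) (F : aggregation_rule R d).
Hypotheses (b0 : 0 <= b) (rho0 : 0 <= rho) (mu0 : 0 <= mu).
Hypothesis (b_small : 2 * rho * b <= mu).
Hypothesis robustF : robust_summation b rho F.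
Hypothesis G_in : in_Gamma G mu b.
Hypothesis eta_gt0 : 0 < eta.
Hypothesis eta_max : mu_max G != 0 -> eta <= (mu_max G)^-1.
Variables (x : V -> 'rV[R]_d) (m : V -> V -> 'rV[R]_d).

Local Notation h := #|honest G|.
Local Notation L := (laplacianH G).
Local Notation node p := (@enum_val V (honest G) p).

Definition centered k : 'rV[R]_h := \row_p (x (node p) 0 k - meanH G x 0 k).
Definition agg_err p k := (agg G F x m (node p) - honest_flow G x (node p)) 0 k.
Definition energy := \sum_k \sum_p (centered k *m L) 0 p * centered k 0 p.

Lemma card_honest_gt0 : 0 < h%:R :> R.
Proof. by rewrite ltr0n; exact: leq_trans (honest_ge2 G). Qed.

Lemma meanH_coord (z : V -> 'rV[R]_d) k :
  meanH G z 0 k = h%:R^-1 * \sum_p z (node p) 0 k.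
Proof. by rewrite mxE summxE big_enum_val. Qed.

Lemma sum_coord k : \sum_p centered k 0 p = 0.
Proof.
under eq_bigr do rewrite mxE.
rewrite sumrB sumr_const card_ord meanH_coord -[(_ * _) *+ _]mulr_natl.
rewrite mulrA mulfV ?mul1r ?subrr //.
by rewrite gt_eqF // card_honest_gt0.
Qed.

Lemma msdH_coord (z : V -> 'rV[R]_d) (c : 'rV[R]_d) :
  msdH G z c = h%:R^-1 * \sum_k \sum_p (z (node p) 0 k - c 0 k) ^+ 2.
Proof.
rewrite /msdH big_enum_val exchange_big; congr (_ * _); apply: eq_bigr => p _ /=.
by rewrite enorm_sqr; apply: eq_bigr => k _; rewrite !mxE.
Qed.

Lemma VarH_coord : VarH G x = h%:R^-1 * \sum_k \sum_p centered k 0 p ^+ 2.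
Proof.
rewrite /VarH msdH_coord; congr (_ * _); apply: eq_bigr => k _.
by apply: eq_bigr => p _; rewrite [centered k 0 p]mxE.
Qed.

Lemma honest_flow_coord p k : honest_flow G x (node p) 0 k = (centered k *m L) 0 p.
Proof.
rewrite /honest_flow sum_nbrH => [|j /weight_nonedge ->]; last exact: scale0r.
rewrite mul_laplacianH summxE; apply: eq_bigr => q _.
by rewrite !mxE; ring.
Qed.

Lemma RG_coord p k :
  RG G F eta x m (node p) 0 k - meanH G x 0 k =
  centered k 0 p - eta * (centered k *m L) 0 p - eta * agg_err p k.
Proof.
rewrite -honest_flow_coord /agg_err /RG -/(agg G F x m (node p)) [centered k 0 p]mxE.
move: (agg _ _ _ _ _) (honest_flow _ _) (meanH _ _) => a f c.
by rewrite !mxE; ring.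
Qed.

(** Summing the nodewise bounds counts each honest edge from both ends, which is twice the Dirichlet
    energy; centering cancels in differences. *)
Lemma err_bound : \sum_k \sum_p agg_err p k ^+ 2 <= 2 * rho * b * energy.
Proof.
rewrite exchange_big /=.
apply: (@le_trans _ _ (\sum_p rho * b * \sum_q
    weight G (node p) (node q) * enorm (x (node p) - x (node q)) ^+ 2)).
  apply: ler_sum => p _; rewrite -enorm_sqr.
  apply: le_trans (agg_error robustF x m _) _.
    exact/(G_in.2)/enum_valP.
  by rewrite sum_nbrH // => j /weight_nonedge ->; rewrite mul0r.
rewrite -mulr_sumr -!mulrA [2 * _]mulrC -!mulrA.
apply: ler_wpM2l => //; apply: ler_wpM2l => //.
rewrite mulrC mulr_sumr; under [leRHS]eq_bigr do rewrite laplacianH_form.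
rewrite [leRHS]exchange_big /=; apply: ler_sum => p _.
rewrite [leRHS]exchange_big /=; apply: ler_sum => q _.
rewrite -mulr_sumr enorm_sqr; apply: ler_wpM2l; first exact: weight_ge0.
by apply: ler_sum => k _; rewrite !mxE opprB addrA subrK.
Qed.

Lemma spectral_bounds :
  let N := \sum_k \sum_p centered k 0 p ^+ 2 in
  [/\ eta * mu <= 1, eta * energy <= N, mu * N <= energy &
    \sum_k \sum_p (centered k 0 p - eta * (centered k *m L) 0 p) ^+ 2
      <= (1 - eta * mu) * (N - eta * energy)].
Proof.
have const_neq0 : (const_mx 1 : 'rV[R]_h) != 0.
  apply/negP => /eqP/rowP/(_ (Ordinal (ltnW (honest_ge2 G)))).
  by rewrite !mxE => /eqP; rewrite oner_eq0.
have [eta_mu step] := psd_contraction (laplacianH_sym G) (@laplacianH_psd _ _ G)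
  (honest_ge2 G) const_neq0 (laplacianH_const G) mu0 G_in.1 (ltW eta_gt0) eta_max.
have orth k : \sum_p (const_mx 1 : 'rV[R]_h) 0 p * centered k 0 p = 0.
  by rewrite -[RHS](sum_coord k); apply: eq_bigr => p _; rewrite mxE mul1r.
rewrite /energy; split=> //.
- by rewrite mulr_sumr; apply: ler_sum => k _; case: (step _ (orth k)).
- by rewrite mulr_sumr; apply: ler_sum => k _; case: (step _ (orth k)).
- rewrite [eta * (\sum_k _)]mulr_sumr -sumrB mulr_sumr.
  by apply: ler_sum => k _; case: (step _ (orth k)).
Qed.

Lemma RG_deviation : msdH G (RG G F eta x m) (meanH G x)
  <= (1 - eta * (mu - 2 * rho * b)) * VarH G x.
Proof.
have [eta_mu E_le N_le step] := spectral_bounds.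
rewrite msdH_coord VarH_coord mulrCA ler_wpM2l ?invr_ge0 ?ler0n //.
set N := \sum_k _ in E_le N_le step *.
under eq_bigr do under eq_bigr do rewrite RG_coord.
have N0 : 0 <= N by apply: sumr_ge0 => k _; apply: sumr_ge0 => p _; exact: sqr_ge0.
have E0 : 0 <= energy by apply: le_trans N_le; rewrite mulr_ge0.
have rb0 : 0 <= 2 * rho * b by rewrite !mulr_ge0.
have eta0 := ltW eta_gt0.
(* The fraction of the spectral gap used up by the error. If [mu = 0], the quotient is 0 by
   convention and [b_small] forces [2 * rho * b = 0], so [sE] still holds. *)
pose s := 2 * rho * b / mu.
have [s01 sE] : 0 <= s <= 1 /\ 2 * rho * b = s * mu.
  have [muE|muN0] := eqVneq mu 0.
    rewrite /s muE invr0 mulr0 mul0r lexx ler01; split=> //.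
    by apply/le_anti; rewrite rb0 -muE b_small.
  have mu_gt0 : 0 < mu by rewrite lt_neqAle eq_sym muN0.
  by rewrite /s divr_ge0 // ler_pdivrMr // mul1r b_small divfK.
rewrite pair_big /=.
(* [B] is chosen so that [t * B] is exactly the error bound [eta^2 * (s * mu) * energy]. *)
apply: le_trans (young_sum (t := eta * mu) (A := N - eta * energy)
  (B := eta * s * energy) _ _ _ _ _) _.
- by rewrite mulr_ge0.
- by rewrite subr_ge0.
- by case/andP: s01 => s0 _; rewrite mulr_ge0 // mulr_ge0.
- by rewrite pair_big /= in step.
- rewrite -(pair_big xpredT xpredT (fun k p => (eta * agg_err p k) ^+ 2)) /=.
  have -> : \sum_k \sum_p (eta * agg_err p k) ^+ 2 =
      eta ^+ 2 * \sum_k \sum_p agg_err p k ^+ 2.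
    rewrite mulr_sumr; apply: eq_bigr => k _; rewrite mulr_sumr.
    by apply: eq_bigr => p _; rewrite exprMn.
  apply: le_trans (ler_wpM2l (sqr_ge0 eta) err_bound) _.
  by rewrite sE le_eqVlt; apply/orP; left; apply/eqP; ring.
rewrite sE -subr_ge0.
have -> : (1 - eta * (mu - s * mu)) * N - (N - eta * energy + eta * s * energy) =
  eta * (1 - s) * (energy - mu * N) by ring.
by case/andP: s01 => _ s1; rewrite !mulr_ge0 // subr_ge0.
Qed.

Lemma RG_drift : enorm (meanH G (RG G F eta x m) - meanH G x) ^+ 2
  <= 2 * rho * b * eta * VarH G x.
Proof.
have [_ E_le _ _] := spectral_bounds.
have eta0 := ltW eta_gt0; have h0 := card_honest_gt0.
have hN0 : h%:R != 0 :> R by rewrite gt_eqF.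
have drift k : (meanH G (RG G F eta x m) - meanH G x) 0 k =
    - (h%:R^-1 * eta * \sum_p agg_err p k).
  transitivity (h%:R^-1 * \sum_p (RG G F eta x m (node p) 0 k - meanH G x 0 k)).
    rewrite sumrB sumr_const card_ord mulrBr -meanH_coord.
    rewrite -[meanH G x 0 k *+ _]mulr_natl.
    by rewrite mulrA mulVf // mul1r !mxE.
  under eq_bigr do rewrite RG_coord.
  rewrite !sumrB -!mulr_sumr sum_coord sum_mul_laplacianH; ring.
rewrite enorm_sqr VarH_coord.
(* Cauchy-Schwarz over the honest nodes costs one of the two factors [h%:R^-1]. *)
apply: (@le_trans _ _ (h%:R^-1 * eta ^+ 2 * \sum_k \sum_p agg_err p k ^+ 2)).
  rewrite mulr_sumr; apply: ler_sum => k _; rewrite drift sqrrN !exprMn.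
  have -> : h%:R^-1 * eta ^+ 2 * \sum_p agg_err p k ^+ 2 =
    h%:R^-1 ^+ 2 * eta ^+ 2 * (h%:R * \sum_p agg_err p k ^+ 2) by field.
  by apply: ler_wpM2l (sqr_sum_le _); rewrite mulr_ge0 ?sqr_ge0.
apply: (@le_trans _ _ (h%:R^-1 * eta ^+ 2 * (2 * rho * b * energy))).
  by apply: ler_wpM2l err_bound; rewrite mulr_ge0 ?sqr_ge0 ?invr_ge0 ?ltW.
(* One factor [eta] is absorbed by [eta * energy <= N]; the other remains in the bound. *)
have -> : h%:R^-1 * eta ^+ 2 * (2 * rho * b * energy) =
  2 * rho * b * eta * (h%:R^-1 * (eta * energy)) by ring.
by rewrite ler_wpM2l ?ler_wpM2l ?invr_ge0 ?ler0n // !mulr_ge0.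
Qed.

End OneStep.

(* If [mu_max G = 0] then [(mu_max G)^-1] is read as +oo, i.e. there is no
   upper bound on the step-size. *)
Theorem theorem3p3 (R : realType) (d : nat) (V : finType)
    (b rho mu_min eta : R) (F : aggregation_rule R d) (G : network R V) :
  0 <= b -> 0 <= rho -> 0 <= mu_min -> 2 * rho * b <= mu_min ->
  robust_summation b rho F ->
  in_Gamma G mu_min b ->
  0 < eta -> (mu_max G != 0 -> eta <= (mu_max G)^-1) ->
  (forall (x : V -> 'rV[R]_d) (m : V -> V -> 'rV[R]_d),
     let xp := RG G F eta x m in
     msdH G xp (meanH G x)
       <= (1 - eta * (mu_min - 2 * rho * b)) * VarH G x
     /\ enorm (meanH G xp - meanH G x) ^+ 2
       <= 2 * rho * b * eta * VarH G x)
  /\ (2 * rho * b < mu_min ->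
      r_robust G (RG G F eta) (1 - eta * (mu_min - 2 * rho * b))).
Proof.
move=> b0 rho0 mu0 b_small robustF G_in eta_gt0 eta_max.
split=> [x m|b_lt].
  split; first exact: RG_deviation.
  exact: (RG_drift b0 rho0 mu0 robustF G_in).
split=> [|x m]; first by rewrite ltrBlDr ltrDl mulr_gt0 // subr_gt0.
exact: RG_deviation.
Qed.
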